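(* Let $n\in\mathbb{N}^+$ and let $(m_e)_{e\ge 0}$ be non-negative integers, only finitely many non-zero, with $n=\sum_{e\ge0} m_e\cdot 2^e$. Then the number of shapes of order $n$ in which, for every $e\ge 0$, exactly $m_e$ entries equal $2^e$ is \[ \frac{\left(\sum_{e\ge1} m_e\right)!}{\prod_{e\ge 1} m_e!}. \] Each such shape has length $k=\sum_{e\ge0}m_e$.
   Context: For a finite chain $I=\{0<1<\dots<k-1\}$, a semilattice direct system of Boolean algebras over $I$ consists of finite Boolean algebras $\mathbf{A}_0,\dots,\mathbf{A}_{k-1}$ and Boolean homomorphisms $p_{ii'}:\mathbf{A}_i\to\mathbf{A}_{i'}$ for $i\le i'$ with $p_{ii}=\mathrm{id}$ and $p_{i'i''}\circ p_{ii'}=p_{ii''}$. (Its Płonka sum is a linearly ordered involutive bisemilattice with $\sum_i|A_i|$ elements.) A shape of order $n$ is a finite sequence $(c_0,\dots,c_{k-1})$ of positive integers for which there exists such a system over the chain $\{0<\dots<k-1\}$ with $|A_i|=c_i$ for all $i$ and $\sum_i c_i=n$ (so each $c_i$ is a power of $2$, with $c_i=1=2^0$ exactly when $\mathbf{A}_i$ is trivial). Two shapes are the same iff they are equal as sequences. *)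

(* Defs.v *)
From HB Require Import structures.
From mathcomp Require Import all_boot all_order all_algebra finmap.
From mathcomp Require Import boolp classical_sets functions cardinality fsbigop.

Set Implicit Arguments.
Unset Strict Implicit.
Unset Printing Implicit Defensive.

Import Order.Theory.
Local Open Scope order_scope.

Definition boolean_hom d d' (A : ctbDistrLatticeType d)
    (B : ctbDistrLatticeType d') (f : A -> B) : Prop :=
  [/\ {morph f : x y / x `&` y}, {morph f : x y / x `|` y},
      {morph f : x / ~` x}, f \bot = \bot & f \top = \top].

(* The structure [finCTBDistrLatticeType] does not require [\bot != \top], so
   the one-element Boolean algebra is included.  The display [bds_disp] is only
   a notational tag and carries no mathematical content. *)
Record boolean_direct_system (k : nat) := BooleanDirectSystem {
  bds_disp : Order.disp_t;
  bds_alg : 'I_k -> finCTBDistrLatticeType bds_disp;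
  bds_map : forall i j : 'I_k, (i <= j)%N -> bds_alg i -> bds_alg j;
  bds_map_hom : forall (i j : 'I_k) (ij : (i <= j)%N), boolean_hom (bds_map ij);
  bds_map_id : forall (i : 'I_k) (ii : (i <= i)%N), bds_map ii =1 id;
  bds_map_comp : forall (i j l : 'I_k)
    (ij : (i <= j)%N) (jl : (j <= l)%N) (il : (i <= l)%N),
    bds_map jl \o bds_map ij =1 bds_map il }.

Definition is_shape (n : nat) (c : seq nat) : Prop :=
  [/\ all (leq 1) c, sumn c = n &
      exists S : boolean_direct_system (size c),
        forall i : 'I_(size c), #|bds_alg S i| = nth 0%N c i].

Local Open Scope classical_set_scope.

Definition shapes_with (n : nat) (m : nat -> nat) : set (seq nat) :=
  [set c | is_shape n c /\ forall e, count_mem (2 ^ e)%N c = m e].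

(* Main.v *)
(** Homomorphisms preserve [\bot] and [\top], so nothing maps a trivial algebra
    to a nontrivial one: in a shape all entries [1] come last.  Conversely any
    sequence of powers of 2 whose entries [1] come last is a shape: take powersets
    of ordinals, and let every map between distinct nontrivial algebras factor
    through the two-element algebra by evaluation at the point [0].  Shapes are
    thus in bijection with the arrangements of the multiset of entries [> 1]. *)

Require Import Defs.
From mathcomp Require Import all_boot all_order all_algebra finmap.
From mathcomp Require Import boolp classical_sets functions cardinality fsbigop.

Set Implicit Arguments.
Unset Strict Implicit.
Unset Printing Implicit Defensive.

Import GRing.Theory.
Import Order.DefaultSetSubsetOrder.
Local Open Scope classical_set_scope.
Local Open Scope ring_scope.

(** Induction on the length, sorting the permutations of [s] by their first entry [x]: the rest
    permutes [rem x s], and the multiplicities of the distinct [x] add up to [size s]. The list [r]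
    stays fixed because removing [x] may shrink the support of [s]; an absent value contributes
    [0! = 1]. *)
Lemma size_permutations_mul_prod_fact (T : eqType) (r s : seq T) :
  uniq r -> {subset s <= r} ->
  (size (permutations s) * \prod_(x <- r) (count_mem x s)`! = (size s)`!)%N.
Proof.
move=> r_uniq; move k_def: (size s) => k.
elim: k s k_def => [|k IHk] s.
  by move/size0nil=> -> _; rewrite big1.
move=> size_s sub_sr; have s_gt0 : (0 < size s)%N by rewrite size_s.
rewrite (perm_size (permutationsE s_gt0)) size_allpairs_dep sumnE big_map.
rewrite big_distrl /= factS -size_s.
have -> : size s = (\sum_(x <- undup s) count_mem x s)%N.
  rewrite -[LHS](perm_size (perm_count_undup s)) size_flatten /shape -map_comp.
  rewrite sumnE big_map; apply: eq_bigr => x _ /=; exact: size_nseq.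
rewrite big_distrl /= big_seq [RHS]big_seq; apply: eq_bigr => x.
rewrite mem_undup => xs.
have size_rem_s : size (rem x s) = k by rewrite size_rem // size_s.
rewrite -(IHk (rem x s)) // => [|y /mem_rem/sub_sr //].
rewrite mulnCA; congr muln.
(* The multiplicity of [x] lifts its factorial from [rem x s] to [s]; the factorials of the other
   values are unchanged. *)
rewrite !(bigD1_seq x) ?sub_sr //= mulnA; congr muln.
  have count_x : count_mem x s = (count_mem x (rem x s)).+1.
    by rewrite (permP (perm_to_rem xs)) /= eqxx.
  by rewrite count_x factS.
apply: eq_bigr => y neq_yx.
by rewrite (permP (perm_to_rem xs)) /= eq_sym (negPf neq_yx).
Qed.

Lemma count_mem_flatten_nseq (T U : eqType) (f : T -> U) (m : T -> nat)
    (r : seq T) (x : T) : injective f -> uniq r ->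
  count_mem (f x) (flatten [seq nseq (m y) (f y) | y <- r]) =
  (if x \in r then m x else 0)%N.
Proof.
move=> f_inj; elim: r => //= y r IHr /andP[yr r_uniq].
rewrite count_cat IHr // count_nseq /= (inj_eq f_inj) inE.
have [yx|_] := eqVneq y x; last by rewrite mul0n.
by rewrite mul1n -yx (negPf yr) addn0.
Qed.

(** By duality it suffices to compose maps of points going from [j] back to [i]: taking preimages
    always gives a Boolean homomorphism. *)
Lemma powerset_system (k : nat) (e : 'I_k -> nat) :
  (forall i j : 'I_k, (i <= j)%N -> (0 < e j)%N -> (0 < e i)%N) ->
  exists S : boolean_direct_system k, forall i, #|bds_alg S i| = (2 ^ e i)%N.
Proof.
move=> e_gt0.
(* Identity for [i = j], constant 0 otherwise; passing through [nat] avoids a transport along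
   [i = j]. A point [y] shows [0 < e j], so by [e_gt0] the point 0 exists over [i]. *)
have pt_subproof (i j : 'I_k) (ij : (i <= j)%N) (y : 'I_(e j)) :
    ((if i == j then y : nat else 0) < e i)%N.
  by case: eqP => [->|_] //; apply: e_gt0 ij (leq_ltn_trans _ (ltn_ord y)).
pose pt i j ij y := Ordinal (@pt_subproof i j ij y).
pose A i : finCTBDistrLatticeType _ := {set 'I_(e i)}.
pose p i j ij (X : A i) : A j := (@pt i j ij @^-1: X)%SET.
have p_hom i j ij : boolean_hom (@p i j ij).
  split=> [X Y|X Y|X||]; rewrite /p.
  - exact: preimsetI.
  - exact: preimsetU.
  - exact: preimsetC.
  - exact: preimset0.
  - exact: preimsetT.
have p_id (i : 'I_k) (ii : (i <= i)%N) : @p i i ii =1 id.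
  move=> X; apply/finset.setP=> y; rewrite inE.
  by have -> : pt i i ii y = y by apply: val_inj; rewrite /= eqxx.
have p_comp (i j l : 'I_k) ij jl il : @p j l jl \o @p i j ij =1 @p i l il.
  move=> X; apply/finset.setP=> y; rewrite !inE.
  suff -> : pt i j ij (pt j l jl y) = pt i l il y by [].
  (* For distinct [i] and [j] the composite is constantly 0, and [i = l] is impossible since
     [i <= j <= l] would force [i = j]. *)
  apply: val_inj => /=; case: (eqVneq i j) => [-> //|neq_ij].
  case: eqP => // il_eq; case/eqP: neq_ij; apply/val_inj/anti_leq.
  by rewrite ij /= il_eq jl.
exists (BooleanDirectSystem p_hom p_id p_comp) => i /=.
by rewrite -cardsT -finset.powersetT card_powerset cardsT card_ord.
Qed.

Definition ones_last : rel nat := [rel x y | (x == 1) ==> (y == 1)]%N.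

Lemma system_ones_last (c : seq nat) (S : boolean_direct_system (size c)) :
  all (leq 1) c -> (forall i, #|bds_alg S i| = nth 0%N c i) ->
  pairwise ones_last c.
Proof.
move=> c_ge1 S_card; apply/(pairwiseP 0%N) => i j lt_ic lt_jc /ltnW ij.
apply/implyP => /eqP ci1.
pose i' : 'I_(size c) := Ordinal lt_ic; pose j' : 'I_(size c) := Ordinal lt_jc.
have [_ _ _ p0 p1] := @bds_map_hom _ S i' j' ij.
have /fintype_le1P trivial_i : (#|bds_alg S i'| <= 1)%N.
  by rewrite S_card /= ci1.
have bot_top_j : \bot%O = \top%O :> bds_alg S j'.
  by rewrite -p0 -p1 (trivial_i \bot%O \top%O).
have : (#|bds_alg S j'| <= 1)%N.
  apply/fintype_le1P => x y.
  have all_bot z : z = \bot%O :> bds_alg S j'.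
    by apply/eqP; rewrite -Order.BPOrderTheory.lex0 bot_top_j Order.TPreorderTheory.lex1.
  by rewrite (all_bot x) (all_bot y).
rewrite S_card /= => cj_le1; rewrite eqn_leq cj_le1.
by move/allP: c_ge1; apply; apply: mem_nth.
Qed.

(** A leading 1 forces the whole tail to consist of ones. Thus a shape is determined by its entries
    other than 1 and the number of ones. *)
Lemma ones_last_split (c : seq nat) :
  pairwise ones_last c ->
  c = [seq x <- c | x != 1%N] ++ nseq (count_mem 1%N c) 1%N.
Proof.
elim: c => //= x c IHc /andP[x_c c_pw].
have [x1|_] /= := eqVneq x 1%N; last by rewrite -IHc.
have c_ones : all (pred1 1%N) c.
  by apply: sub_all x_c => y; rewrite /= x1.
rewrite (eq_in_filter (a2 := pred0)) ?filter_pred0 /=; last first.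
  by move=> y /(allP c_ones) /= ->.
move: (c_ones); rewrite all_count => /eqP ->.
by rewrite x1; congr cons; apply/all_pred1P.
Qed.

Lemma is_shape_pow2 (c : seq nat) :
  {in c, forall x, exists e, x = (2 ^ e)%N} -> pairwise ones_last c ->
  is_shape (sumn c) c.
Proof.
move=> c_pow2 /(pairwiseP 0%N) c_pw; split=> //.
  by apply/allP => x /c_pow2[e ->]; rewrite expn_gt0.
have nthE (i : 'I_(size c)) : nth 0%N c i = (2 ^ logn 2 (nth 0%N c i))%N.
  by have [e ->] := c_pow2 _ (mem_nth 0%N (ltn_ord i)); rewrite pfactorK.
have [i j ij|S S_card] :=
    @powerset_system (size c) (fun i => logn 2 (nth 0%N c i)).
  (* Contrapositive: exponent 0 at [i] means entry 1 there, hence entry 1 at [j] as well. *)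
  rewrite !lt0n; apply: contraNneq => ci0.
  have ci1 : nth 0%N c i = 1%N by rewrite nthE ci0.
  move: ij; rewrite leq_eqVlt => /orP[/eqP <- //|ij]; first by rewrite ci0.
  have := c_pw _ _ (ltn_ord i) (ltn_ord j) ij.
  by rewrite /= ci1 /= => /eqP ->.
by exists S => i; rewrite S_card -nthE.
Qed.

(** Exponent 0 is kept apart from [r] because the ones form a fixed final block; only the entries
    above 1, collected in [t], are permuted. *)
Lemma shapes_withE (n : nat) (m : nat -> nat) (r : seq nat) :
  uniq (0%N :: r) -> (forall e, e \notin 0%N :: r -> m e = 0%N) ->
  n = (\sum_(e <- 0%N :: r) m e * 2 ^ e)%N ->
  shapes_with n m = [set` [seq s ++ nseq (m 0%N) 1%N | s <- permutations
      (flatten [seq nseq (m e) (2 ^ e)%N | e <- r])]].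
Proof.
set t := flatten _; move=> r_uniq m_supp n_eq.
have [r0 r_uniq'] := andP r_uniq.
pose u := flatten [seq nseq (m e) (2 ^ e)%N | e <- 0%N :: r].
have uE : perm_eq u (t ++ nseq (m 0%N) 1%N) by rewrite /u /= perm_catC.
have exp2_inj : injective (expn 2) by apply: expnI.
have count_u e : count_mem (2 ^ e)%N u = m e.
  by rewrite count_mem_flatten_nseq //; case: ifPn => // /m_supp.
have u_pow2 x : x \in u -> exists e, x = (2 ^ e)%N.
  by case/flattenP => l /mapP[e _ ->] /nseqP[-> _]; exists e.
have sumn_u : sumn u = n.
  rewrite sumn_flatten -map_comp sumnE big_map n_eq.
  by apply: eq_bigr => e _ /=; rewrite sumn_nseq mulnC.
have t_neq1 x : x \in t -> x != 1%N.
  case/flattenP => l /mapP[e er ->] /nseqP[-> _].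
  by rewrite -(expn0 2) (inj_eq exp2_inj); apply: contraNneq r0 => <-.
have filter_t (s : seq nat) : perm_eq s t -> [seq x <- s | x != 1%N] = s.
  by move=> st; apply/all_filterP/allP => x; rewrite (perm_mem st); apply: t_neq1.
apply/seteqP; split=> c /=.
  case=> -[c_ge1 c_sum [S S_card]] c_count.
  have c_u : perm_eq c u.
    (* The hypothesis on [c] counts powers of 2 only, so at first it bounds [u] by [c] as multisets;
       [c] might still have other entries. *)
    have /count_subseqP[s s_c u_s] x : (count_mem x u <= count_mem x c)%N.
      have [/u_pow2[e ->]|/count_memPn -> //] := boolP (x \in u).
      by rewrite count_u c_count.
    have [s' c_s] := perm_to_subseq s_c.
    (* [u] and [c] have the same sum and all entries of [c] are positive, so
       nothing is left over once the powers of two are counted. *)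
    have : sumn s' = 0%N.
      apply: (@addnI n); rewrite addn0 -[in LHS]sumn_u (perm_sumn u_s) -sumn_cat.
      by rewrite -(perm_sumn c_s).
    case: s' c_s => [|x s'] c_s; first by rewrite (permPl c_s) cats0 perm_sym.
    have : x \in c by rewrite (perm_mem c_s) mem_cat inE eqxx orbT.
    by move/(allP c_ge1); case: x c_s.
  have c_split := ones_last_split (system_ones_last c_ge1 S_card).
  apply/mapP; exists [seq x <- c | x != 1%N]; last first.
    by rewrite {1}c_split -(c_count 0%N).
  rewrite mem_permutations -[t]filter_t //.
  rewrite (permPl (perm_filter _ c_u)) (permPl (perm_filter _ uE)) filter_cat.
  by rewrite (filter_nseq _ (m 0%N)) cats0.
case/mapP=> s; rewrite mem_permutations => st ->.
have c_u : perm_eq (s ++ nseq (m 0%N) 1%N) u.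
  by rewrite (permPr uE) perm_cat2r.
split; last by move=> e; rewrite (permP c_u).
rewrite -sumn_u -(perm_sumn c_u); apply: is_shape_pow2.
  by move=> x; rewrite (perm_mem c_u) => /u_pow2.
(* Across the cut the later entry is 1; inside [s] no entry is 1, so the implication is vacuous;
   inside the block every entry is 1. *)
rewrite pairwise_cat; apply/and3P; split.
- by apply/allrelP => x y _ /nseqP[-> _]; apply: implybT.
- apply/(pairwiseP 0%N) => i j lt_is _ _.
  by rewrite /ones_last /= (negPf (t_neq1 _ _)) // -(perm_mem st) mem_nth.
- by elim: (m 0%N) => //= k ->; rewrite andbT; apply/allP => x /nseqP[->].
Qed.

Theorem theorem4 (n : nat) (m : nat -> nat)
    (n_gt0 : (0 < n)%N)
    (m_fin : finite_set [set e | m e != 0%N])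
    (n_eq : n = \big[addn/0%N]_(e \in [set: nat]) (m e * 2 ^ e)%N) :
  [/\ finite_set (shapes_with n m),
      #|` fset_set (shapes_with n m)|%:R =
        (\big[addn/0%N]_(e \in [set e | (1 <= e)%N]) m e)`!%:R
          / (\big[muln/1%N]_(e \in [set e | (1 <= e)%N]) (m e)`!)%:R :> rat
    & forall c : seq nat, shapes_with n m c ->
        size c = \big[addn/0%N]_(e \in [set: nat]) m e].
Proof.
have [s s_supp] := (finite_seqP _).1 m_fin.
pose r := [seq e <- undup s | 0 < e]%N.
have r_uniq : uniq (0%N :: r).
  by rewrite /= filter_uniq ?undup_uniq // mem_filter.
have m_supp e : e \notin 0%N :: r -> m e = 0%N.
  rewrite inE negb_or mem_filter mem_undup lt0n => /andP[-> /= es].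
  apply/eqP; apply: contraNT es => me.
  by have : [set` s] e by rewrite -s_supp.
have r_pos : [set` r] `<=` [set e | (1 <= e)%N].
  by move=> e /=; rewrite mem_filter => /andP[].
have m_supp_pos e : (1 <= e)%N -> e \notin r -> m e = 0%N.
  by move=> e_gt0 er; apply: m_supp; rewrite inE negb_or -lt0n e_gt0.
have fsum_all (F : nat -> nat) : (forall e, m e = 0%N -> F e = 0%N) ->
    \big[addn/0%N]_(e \in [set: nat]) F e = (\sum_(e <- 0%N :: r) F e)%N.
  move=> F0; rewrite (fsbigE (0%N :: r)) //; last by move=> e _ /m_supp/F0.
  by apply: eq_bigl => e; rewrite in_setT.
have sum_pos : \big[addn/0%N]_(e \in [set e | (1 <= e)%N]) m e =
    (\sum_(e <- r) m e)%N.
  rewrite (fsbigE r) //; [|by case/andP: r_uniq..].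
  rewrite big_seq_cond [RHS]big_seq; apply: eq_bigl => e.
  by apply/andb_idr => er; rewrite inE; apply: r_pos.
(* Exponents outside [r] have [m e = 0] and contribute the neutral factor [0! = 1]. *)
have prod_pos : \big[muln/1%N]_(e \in [set e | (1 <= e)%N]) (m e)`! =
    (\prod_(e <- r) (m e)`!)%N.
  rewrite (fsbigE r) //; first last.
  - by move=> e e_gt0 er; rewrite m_supp_pos.
  - by case/andP: r_uniq.
  rewrite big_seq_cond [RHS]big_seq; apply: eq_bigl => e.
  by apply/andb_idr => er; rewrite inE; apply: r_pos.
rewrite fsum_all in n_eq; last by move=> e ->.
rewrite sum_pos prod_pos fsum_all //.
rewrite (shapes_withE r_uniq m_supp n_eq).
set t := flatten _; set shapes := [seq _ | _ <- _].
have size_t : size t = (\sum_(e <- r) m e)%N.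
  rewrite size_flatten /shape -map_comp sumnE big_map.
  by apply: eq_bigr => e _ /=; rewrite size_nseq.
have shapes_fin : finite_set [set` shapes] by apply/finite_seqP; exists shapes.
split=> //.
- have -> : fset_set [set` shapes] = [fset x in shapes]%fset.
    by apply/fsetP => x; rewrite in_fset_set // inE /= mem_setE.
  (* No shape is listed twice: equal results have prefixes of equal size, hence equal prefixes. *)
  rewrite card_fseq undup_id; last first.
    rewrite map_inj_uniq ?permutations_uniq // => x y xy.
    have := congr1 size xy; rewrite !size_cat => /addIn size_xy.
    by move/eqP: xy; rewrite eqseq_cat // => /andP[/eqP].
  have exp2_inj : injective (expn 2) by apply: expnI.
  rewrite size_map -size_t.
  (* The multinomial identity is applied to the values [2 ^ e]; injectivity of [expn 2] turns their
     multiplicities in [t] back into [m e]. *)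
  rewrite -(@size_permutations_mul_prod_fact _ [seq expn 2 e | e <- r] t); first last.
  - move=> x /flattenP[l /mapP[e er ->] /nseqP[-> _]]; exact: map_f.
  - by rewrite map_inj_uniq //; case/andP: r_uniq.
  rewrite big_map natrM.
  rewrite (eq_big_seq (fun e => (m e)`!)) => [|e er]; last first.
    by rewrite count_mem_flatten_nseq ?er //; case/andP: r_uniq.
  rewrite mulfK // Num.Theory.pnatr_eq0 -lt0n.
  by apply: prodn_gt0 => e; apply: fact_gt0.
- move=> c /= /mapP[p]; rewrite mem_permutations => pt ->.
  by rewrite size_cat size_nseq (perm_size pt) size_t big_cons addnC.
Qed.
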